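(* Being reducible is a quasi-isometry invariant of group pairs: if $(G,\mathcal{P})$ and $(H,\mathcal{Q})$ are quasi-isometric group pairs, then $(G,\mathcal{P})$ is reducible if and only if $(H,\mathcal{Q})$ is reducible.
   Context: A group pair $(G,\mathcal{P})$ is a finitely generated group $G$ together with a finite collection $\mathcal{P}$ of infinite subgroups of $G$. $G$ carries a fixed word metric with respect to a finite generating set and $\mathrm{hdist}_G$ is the corresponding Hausdorff distance between subsets. $G/\mathcal{P}$ is the set of all left cosets $gP$, $g\in G$, $P\in\mathcal{P}$. $(G,\mathcal{P})$ and $(H,\mathcal{Q})$ are quasi-isometric if there are a quasi-isometry $q\colon G\to H$ and $M>0$ such that for every $A\in G/\mathcal{P}$ there is $B\in H/\mathcal{Q}$ with $\mathrm{hdist}_H(q(A),B)<M$, and for every $B\in H/\mathcal{Q}$ there is $A\in G/\mathcal{P}$ with $\mathrm{hdist}_H(q(A),B)<M$. The commensurator of $P\le G$ is $\mathrm{Comm}_G(P)=\{g\in G: P\cap gPg^{-1}\text{ has finite index in both }P\text{ and }gPg^{-1}\}$. The pair $(G,\mathcal{P})$ is reducible if every $P\in\mathcal{P}$ has finite index in $\mathrm{Comm}_G(P)$. *)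

(* Defs.v *)
From mathcomp Require Import all_boot all_order all_algebra.
From mathcomp Require Import boolp classical_sets functions cardinality.
From mathcomp Require Import reals constructive_ereal ereal.

Set Implicit Arguments.
Unset Strict Implicit.
Unset Printing Implicit Defensive.

Import Order.TTheory GRing.Theory Num.Theory.

Local Open Scope classical_set_scope.
Local Open Scope ring_scope.

Section Subgroups.
Variable G : groupType.
Implicit Types (g : G) (K L P A : set G) (Ps : set (set G)).

Definition is_subgroup P : Prop := group_closed (mem P).

Definition left_coset g P : set G := [set (g * x)%g | x in P].

(* g P g^-1; the library's [x ^ g] is g^-1 x g. *)
Definition conj_set g P : set G := [set (g * x * g^-1)%g | x in P].

(* K has finite index in L; only used when K is a subgroup of L. *)
Definition finite_index K L : Prop :=
  finite_set [set left_coset x K | x in L].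

Definition commensurator P : set G :=
  [set g | finite_index (P `&` conj_set g P) P /\
           finite_index (P `&` conj_set g P) (conj_set g P)].

Definition coset_collection Ps : set (set G) :=
  [set A | exists g, exists2 P, Ps P & A = left_coset g P].

Definition reducible Ps : Prop :=
  forall P, Ps P -> finite_index P (commensurator P).

End Subgroups.

Section WordMetric.
Variables (G : groupType) (S : seq G).
Implicit Types (g x y : G) (w : seq G).

Definition is_word g w : Prop :=
  all (fun s => (s \in S) || ((s^-1)%g \in S)) w /\ (\prod_(s <- w) s)%g = g.

Definition generates : Prop := forall g, exists w, is_word g w.

Definition has_word_of_size g (n : nat) : bool :=
  `[< exists2 w, is_word g w & size w = n >].

(* The least size of a word for g; the value 0 given to elements that are not
   represented by any word is never used when S generates G. *)
Definition word_length g : nat :=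
  if pselect (exists n, has_word_of_size g n) is left ex then ex_minn ex else 0.

Definition word_dist x y : nat := word_length (x^-1 * y)%g.

Section Hausdorff.
Variable R : realType.

Definition thickening (r : R) (A : set G) : set G :=
  [set x | exists2 a, A a & (word_dist x a)%:R <= r].

(* The infimum is +oo when no r is admissible. *)
Definition hdist (A B : set G) : \bar R :=
  ereal_inf [set r%:E | r in [set r : R |
    [/\ 0 <= r, A `<=` thickening r B & B `<=` thickening r A]]].

End Hausdorff.
End WordMetric.
Arguments hdist {G} S {R} A B.

(* S is the finite generating set defining the fixed word metric on G. *)
Record group_pair (G : groupType) (S : seq G) (Ps : set (set G)) : Prop :=
  GroupPair {
    group_pair_generates : generates S;
    group_pair_finite : finite_set Ps;
    group_pair_subgroup : forall P, Ps P -> is_subgroup P;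
    group_pair_infinite : forall P, Ps P -> infinite_set P
  }.

Section QuasiIsometry.
Variables (R : realType) (G H : groupType) (S : seq G) (T : seq H).

Definition quasi_isometry (q : G -> H) : Prop :=
  exists L C : R, [/\ 1 <= L, 0 <= C,
    forall x y, L^-1 * (word_dist S x y)%:R - C
                  <= (word_dist T (q x) (q y))%:R
                  <= L * (word_dist S x y)%:R + C
    & forall z, exists x, (word_dist T (q x) z)%:R <= C].

Definition quasi_isometric_pairs (Ps : set (set G)) (Qs : set (set H)) : Prop :=
  exists (q : G -> H) (M : R), [/\ quasi_isometry q, 0 < M,
    forall A, coset_collection Ps A ->
      exists2 B, coset_collection Qs B & (hdist T (q @` A) B < M%:E)%E
    & forall B, coset_collection Qs B ->
      exists2 A, coset_collection Ps A & (hdist T (q @` A) B < M%:E)%E].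

End QuasiIsometry.

(* Main.v *)
Require Import Defs.
From mathcomp Require Import all_boot all_order all_algebra.
From mathcomp Require Import boolp classical_sets functions cardinality.
From mathcomp Require Import reals constructive_ereal ereal.

(** Call subsets at finite Hausdorff distance coarsely equal.  Two subgroups are
    commensurable iff they are coarsely equal, and gPg^-1 is coarsely equal to
    gP, so Comm(P) consists of the g for which gP is coarsely equal to P.  Hence a
    pair is reducible iff each coset is coarsely equal to only finitely many
    cosets of the collection.  This passes through a quasi-isometry of pairs:
    coarse equality is preserved and reflected, and a given coset corresponds
    to finitely many cosets on the other side, since these all meet one finite
    ball and each point lies in finitely many cosets. *)

Set Implicit Arguments.
Unset Strict Implicit.
Unset Printing Implicit Defensive.

Import Order.TTheory GRing.Theory Num.Theory.

(** * Word length, word distance and finiteness of balls *)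

Section WordLength.
Local Open Scope group_scope.
Local Open Scope classical_set_scope.
Variables (G : groupType) (S : seq G).
Implicit Types (g x y z : G) (w : seq G).

Lemma word_length_le g w : is_word S g w -> word_length S g <= size w.
Proof.
move=> gw; have h : has_word_of_size S g (size w) by apply/asboolP; exists w.
rewrite /word_length; case: pselect => [ex|//].
by case: ex_minnP => m _; apply.
Qed.

Hypothesis Sgen : generates S.

Lemma word_lengthP g : exists2 w, is_word S g w & size w = word_length S g.
Proof.
rewrite /word_length; case: pselect => [ex|nex].
  by case: ex_minnP => m /asboolP.
have [w gw] := Sgen g; exfalso; apply: nex.
by exists (size w); apply/asboolP; exists w.
Qed.

Lemma word_lengthM x y :
  word_length S (x * y) <= word_length S x + word_length S y.
Proof.
have [u [uS ux] <-] := word_lengthP x; have [v [vS vy] <-] := word_lengthP y.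
rewrite -size_cat; apply: word_length_le; split; first by rewrite all_cat uS.
by rewrite big_cat /= ux vy.
Qed.

Lemma word_lengthV_le x : word_length S x^-1 <= word_length S x.
Proof.
have [u [uS ux] <-] := word_lengthP x.
rewrite -size_rev -(size_map (fun s : G => s^-1)); apply: word_length_le; split.
  rewrite all_map all_rev; apply: sub_all uS => s /=.
  by rewrite invgK orbC.
by rewrite big_map prodgV revK ux.
Qed.

Lemma word_dist_leD y x z :
  word_dist S x z <= word_dist S x y + word_dist S y z.
Proof.
rewrite /word_dist -[x^-1 * z](_ : x^-1 * y * (y^-1 * z) = _) ?word_lengthM//.
by rewrite -mulgA mulVKg.
Qed.

Lemma word_dist_sym x y : word_dist S x y = word_dist S y x.
Proof.
suff le x' y' : word_dist S x' y' <= word_dist S y' x'.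
  by apply/eqP; rewrite eqn_leq !le.
rewrite /word_dist -[x'^-1 * y'](_ : (y'^-1 * x')^-1 = _) ?word_lengthV_le//.
by rewrite invgM invgK.
Qed.

Lemma word_dist_mul2l g x y : word_dist S (g * x) (g * y) = word_dist S x y.
Proof. by rewrite /word_dist invgM -mulgA mulKg. Qed.

Lemma word_dist_mulr x g : word_dist S x (x * g) = word_length S g.
Proof. by rewrite /word_dist mulKg. Qed.

(** By induction on [k]: a nonempty word of size at most [k.+1] is a letter followed by a word of
    size at most [k], and there are finitely many letters. *)
Lemma finite_word_ball n : finite_set [set g | word_length S g <= n].
Proof.
pose letters := S ++ map (fun s : G => s^-1) S.
pose prods k := [set g | exists w, [/\ is_word S g w & size w <= k]].
suff fin k : finite_set (prods k).
  apply: sub_finite_set (fin n) => g /=.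
  by have [w gw <-] := word_lengthP g => ?; exists w.
elim: k => [|k IH].
  apply: sub_finite_set (finite_set1 1) => g [w [[_ <-]]].
  by rewrite leqn0 size_eq0 => /eqP->; rewrite big_nil.
apply: (@sub_finite_set _ _
  (prods k `|` [set x * y | x in [set` letters] & y in prods k])).
  move=> g [[|s w] [[sw <-] szw]].
    by left; exists [::]; split => //; split.
  move: sw => /= /andP[sS wS]; right; exists s.
    rewrite /= mem_cat; case/orP: sS => [-> //|sS]; apply/orP; right.
    by rewrite -[s]invgK map_f.
  exists (\prod_(i <- w) i); first by exists w; split.
  by rewrite big_cons.
rewrite finite_setU; split => //.
by apply: finite_image2 => //; exact: finite_seq.
Qed.

Lemma finite_dist_ball x n : finite_set [set y | word_dist S x y <= n].
Proof.
apply: sub_finite_set (finite_image (fun g => x * g) (finite_word_ball n)) => y xy.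
by exists (x^-1 * y); rewrite ?mulVKg.
Qed.

End WordLength.

(** * Coarse equality, cosets and commensurators *)

Section Coarse.
Local Open Scope group_scope.
Local Open Scope classical_set_scope.
Variables (G : groupType) (S : seq G).
Implicit Types (g x y z : G) (A B C P Q : set G) (Ps : set (set G)).

Definition coarse_sub A B : Prop :=
  exists n : nat, forall a, A a -> exists2 b, B b & word_dist S a b <= n.

Definition coarse_eq A B : Prop := coarse_sub A B /\ coarse_sub B A.

Hypothesis Sgen : generates S.

Lemma coarse_sub_trans B A C : coarse_sub A B -> coarse_sub B C -> coarse_sub A C.
Proof.
move=> [m AB] [n BC]; exists (m + n)%N => a /AB[b /BC[c Cc bc] ab].
by exists c => //; rewrite (leq_trans (word_dist_leD Sgen b _ _)) ?leq_add.
Qed.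

Lemma coarse_eq_sym A B : coarse_eq A B -> coarse_eq B A.
Proof. by case. Qed.

Lemma coarse_eq_trans B A C : coarse_eq A B -> coarse_eq B C -> coarse_eq A C.
Proof.
by move=> [AB BA] [BC CB]; split; apply: (coarse_sub_trans (B := B)).
Qed.

Lemma coarse_sub_mull g A B :
  coarse_sub A B -> coarse_sub (left_coset g A) (left_coset g B).
Proof.
move=> [n AB]; exists n => _ [a /AB[b Bb ab] <-].
by exists (g * b); [exists b|rewrite word_dist_mul2l].
Qed.

Lemma coarse_eq_mull g A B :
  coarse_eq A B -> coarse_eq (left_coset g A) (left_coset g B).
Proof. by move=> [AB BA]; split; apply: coarse_sub_mull. Qed.

(** The metric is left invariant, so right multiplication by a fixed element moves all points by the
    same distance. *)
Lemma coarse_eq_conj_set g A : coarse_eq (conj_set g A) (left_coset g A).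
Proof.
split.
  exists (word_length S g) => _ [a Aa <-]; exists (g * a); first by exists a.
  by rewrite -{2}[g * a](mulgVK g) word_dist_mulr.
exists (word_length S g^-1) => _ [a Aa <-]; exists (g * a * g^-1).
  by exists a.
by rewrite word_dist_mulr.
Qed.

Lemma left_cosetM g h A : left_coset g (left_coset h A) = left_coset (g * h) A.
Proof.
apply/seteqP; split => [_ [_ [a Aa <-] <-]|_ [a Aa <-]].
  by exists a; rewrite ?mulgA.
by exists (h * a); [exists a|rewrite mulgA].
Qed.

Lemma left_coset1 A : left_coset 1 A = A.
Proof.
apply/seteqP; split => [_ [a Aa <-]|a Aa]; rewrite ?mul1g//.
by exists a; rewrite ?mul1g.
Qed.

Lemma left_coset_inj g : injective (left_coset g).
Proof.
apply: (can_inj (g := left_coset g^-1)) => A.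
by rewrite left_cosetM mulVg left_coset1.
Qed.

Lemma subgroup1 P : is_subgroup P -> P 1.
Proof. by move=> [/set_mem]. Qed.

Lemma subgroupV P x : is_subgroup P -> P x -> P x^-1.
Proof. by move=> /group_closedV PV /mem_set Px; apply/set_mem/PV. Qed.

Lemma subgroupM P x y : is_subgroup P -> P x -> P y -> P (x * y).
Proof.
by move=> /group_closedM PM /mem_set Px /mem_set Py; apply/set_mem/PM.
Qed.

Lemma conj_set_subgroup g P : is_subgroup P -> is_subgroup (conj_set g P).
Proof.
move=> sP; split.
  by apply/mem_set; exists 1; rewrite ?mulg1 ?mulgV//; exact: subgroup1.
move=> _ _ /set_mem[x Px <-] /set_mem[y Py <-]; apply/mem_set.
exists (x * y^-1); first by apply: subgroupM => //; exact: subgroupV.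
by rewrite !invgM invgK !mulgA mulgVK.
Qed.

Lemma left_coset_eq P x y :
  is_subgroup P -> P (x^-1 * y) -> left_coset x P = left_coset y P.
Proof.
move=> sP Pxy; apply: (@left_coset_inj x^-1).
rewrite !left_cosetM mulVg left_coset1; apply/seteqP; split => [a Pa|_ [a Pa <-]].
  exists ((x^-1 * y)^-1 * a); last by rewrite mulVKg.
  by apply: subgroupM => //; exact: subgroupV.
exact: subgroupM.
Qed.

Lemma left_coset_refl P x : is_subgroup P -> left_coset x P x.
Proof. by move=> sP; exists 1; rewrite ?mulg1//; exact: subgroup1. Qed.

Lemma subgroupI P Q : is_subgroup P -> is_subgroup Q -> is_subgroup (P `&` Q).
Proof.
move=> sP sQ; split; first by apply/mem_set; split; exact: subgroup1.
move=> x y /set_mem[Px Qx] /set_mem[Py Qy]; apply/mem_set.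
by split; apply: subgroupM => //; exact: subgroupV.
Qed.

(** [P] lies near [Q] iff finitely many translates [Q * b^-1] cover it, and each of these meets [P]
    in a right coset of the intersection or not at all. Inversion turns right cosets into the left
    cosets that the index counts. *)
Lemma finite_index_coarse_sub P Q : is_subgroup P -> is_subgroup Q ->
  finite_index (P `&` Q) P <-> coarse_sub P Q.
Proof.
move=> sP sQ; have sPQ := subgroupI sP sQ; split.
  (* An element of p^-1 (P `&` Q) is p^-1 k with k in Q at distance its length from p. *)
  pose len C := word_length S (xget 1 (C : set G)).
  move=> /(finite_image len)/finite_seqP[s Es]; exists (\max_(i <- s) i) => p Pp.
  pose C := left_coset p^-1 (P `&` Q).
  (* [C] contains [p^-1], so the default 1 is not a concern. *)
  have : C (xget 1 C) by apply: (xgetPex 1); exists p^-1; exact: left_coset_refl.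
  case=> k [Pk Qk] pk; exists k => //.
  rewrite -[k](mulVKg p) word_dist_mulr pk.
  apply: leq_bigmax_seq => //.
  suff: [set` s] (len C) by [].
  by rewrite -Es; exists C => //; exists p^-1 => //; exact: subgroupV.
move=> [n PQ].
(* If p1 b and p2 b lie in Q then so does p1 p2^-1, so b determines the coset of p^-1. *)
have {}PQ p : exists b, P p -> word_length S b <= n /\ Q (p * b).
  (* Outside [P] the value 1 is a dummy that makes [b] a total function of [p]. *)
  have [Pp|nPp] := pselect (P p); last by exists 1.
  have [q Qq pq] := PQ p Pp; exists (p^-1 * q) => _.
  by rewrite mulVKg.
have [f Hf] := choice (fun p => PQ p^-1).
pose pick b := xget 1 [set p | P p /\ f p = b].
apply: sub_finite_set
  (finite_image (fun b => left_coset (pick b) (P `&` Q)) (finite_word_ball Sgen n)).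
move=> _ [p Pp <-]; exists (f p).
  by case: (Hf p (subgroupV sP Pp)).
have : [set p' | P p' /\ f p' = f p] (pick (f p)).
  by apply: (xgetPex 1); exists p.
case=> Pp' fp'; apply: left_coset_eq => //; split.
  by apply: subgroupM => //; exact: subgroupV.
have [_ Q1] := Hf _ (subgroupV sP Pp); have [_ Q2] := Hf _ (subgroupV sP Pp').
have := subgroupM sQ Q2 (subgroupV sQ Q1).
by rewrite fp' invgM invgK mulgA mulgK.
Qed.

Lemma commensuratorE P g :
  is_subgroup P -> commensurator P g <-> coarse_eq P (left_coset g P).
Proof.
move=> sP; have sPg := conj_set_subgroup g sP.
(* One index condition puts [P] near its conjugate; the other, with the intersection swapped, puts
   the conjugate near [P]. *)
rewrite /commensurator /= finite_index_coarse_sub// setIC finite_index_coarse_sub//.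
have Pg := coarse_eq_conj_set g P.
split=> [PPg|PPg]; first exact: (coarse_eq_trans (B := conj_set g P)).
exact: (coarse_eq_trans PPg (coarse_eq_sym Pg)).
Qed.

(** A condition on subsets of a metric space only, so that a quasi-isometry can carry it across. *)
Definition coarsely_finite (Cs : set (set G)) : Prop :=
  forall A, Cs A -> finite_set (Cs `&` coarse_eq A).

Lemma reducible_coarsely_finite Ps : group_pair S Ps ->
  reducible Ps <-> coarsely_finite (coset_collection Ps).
Proof.
move=> [_ finPs sPs _]; split=> [red A _|fin P PsP]; last first.
  have /fin : coset_collection Ps P by exists 1, P; rewrite ?left_coset1.
  apply: sub_finite_set => _ [g /(commensuratorE _ (sPs P PsP)) gP <-].
  by split=> //; exists g, P.
(* Sort the cosets by their subgroup [P], of which there are finitely many. *)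
apply: (@sub_finite_set _ _
    (\bigcup_(P in Ps) [set C | coarse_eq A C /\ exists g, C = left_coset g P])).
  by move=> _ [[g [P PsP ->]] Ag]; exists P => //; split => //; exists g.
apply: bigcup_finite => // P PsP.
have [[g0 Ag0]|noA] := pselect (exists g, coarse_eq A (left_coset g P)); last first.
  apply: sub_finite_set (finite_set0 _) => C [AC [g Eg]].
  by apply: noA; exists g; rewrite -Eg.
(* Both [g0 P] and [g P] are coarsely equal to [A]; translating by [g0^-1] shows that [g0^-1 * g]
   commensurates [P]. *)
apply: sub_finite_set (finite_image (left_coset g0) (red P PsP)) => C [AC [g Cg]].
rewrite {C}Cg in AC *; exists (left_coset (g0^-1 * g) P); last by rewrite left_cosetM mulVKg.
exists (g0^-1 * g) => //; apply/commensuratorE; first exact: sPs.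
have := coarse_eq_mull g0^-1 (coarse_eq_trans (coarse_eq_sym Ag0) AC).
by rewrite !left_cosetM mulVg left_coset1.
Qed.

(** A coset of [P] through [x] equals [x P], so it is determined by the pair of [x] and [P]. *)
Lemma finite_cosets_meeting Ps (F : set G) : group_pair S Ps -> finite_set F ->
  finite_set (coset_collection Ps `&` [set A | exists2 x, F x & A x]).
Proof.
move=> [_ finPs sPs _] finF.
apply: sub_finite_set (finite_image2 (@left_coset G) finF finPs).
move=> _ [[g [P PsP ->]] [x Fx gPx]]; exists x => //; exists P => //.
case: gPx => p Pp <-; apply: left_coset_eq; first exact: sPs.
by rewrite invgM mulgVK; apply: subgroupV => //; exact: sPs.
Qed.

Lemma coset_nonempty Ps A : group_pair S Ps -> coset_collection Ps A -> A !=set0.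
Proof.
by move=> [_ _ sPs _] [g [P PsP ->]]; exists g; apply: left_coset_refl; exact: sPs.
Qed.

End Coarse.

(** * Transfer of finite classes along a correspondence *)

Section Transfer.
Local Open Scope classical_set_scope.

(** If [A] corresponds to [B], the class of [B] is covered by the partners of the members of the
    class of [A]. The relation [r] is kept abstract so that its converse can serve for the other
    direction. *)
Lemma finite_class_transfer (T U : Type) (Cs : set T) (Ds : set U)
    (e : T -> set T) (f : U -> set U) (r : T -> set U) :
  (forall B, Ds B -> exists2 A, Cs A & r A B) ->
  (forall A A' B B', r A B -> r A' B' -> f B B' -> e A A') ->
  (forall A, Cs A -> finite_set (Ds `&` r A)) ->
  (forall A, Cs A -> finite_set (Cs `&` e A)) ->
  forall B, Ds B -> finite_set (Ds `&` f B).
Proof.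
move=> ex fe finr fine B /ex[A CsA rAB].
apply: (@sub_finite_set _ _ (\bigcup_(A' in Cs `&` e A) (Ds `&` r A'))).
  move=> B' [DsB' BB']; have [A' CsA' rAB'] := ex B' DsB'.
  by exists A' => //; split => //; exact: fe rAB rAB' BB'.
by apply: bigcup_finite => [|A' [CsA' _]]; [exact: fine|exact: finr].
Qed.

End Transfer.

(** * Quasi-isometries and Hausdorff distance with natural-number bounds *)

Section QuasiIsometries.
Local Open Scope classical_set_scope.
Local Open Scope ring_scope.

Lemma hdist_ltP (R : realType) (G : groupType) (S : seq G) (A B : set G) (M : R) :
  generates S -> (hdist S A B < M%:E)%E ->
  (forall a, A a -> exists2 b, B b & (word_dist S a b <= Num.truncn M)%N) /\
  (forall b, B b -> exists2 a, A a & (word_dist S a b <= Num.truncn M)%N).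
Proof.
move=> Sgen /ereal_inf_lt[_ [r [r0 AB BA] <-]]; rewrite lte_fin => rM.
have le (n : nat) : n%:R <= r -> (n <= Num.truncn M)%N.
  move=> nr; rewrite -ltnS -(ltr_nat R); apply: le_lt_trans (truncnS_gt M).
  exact: le_trans nr (ltW rM).
split=> [a /AB[b Bb ab]|b /BA[a Aa ba]]; first by exists b => //; exact: le.
by exists a => //; rewrite word_dist_sym//; exact: le.
Qed.

Lemma quasi_isometry_nat (R : realType) (G H : groupType) (S : seq G) (T : seq H)
    (q : G -> H) :
  quasi_isometry R S T q ->
  exists K : nat, forall x y,
    (word_dist T (q x) (q y) <= K * word_dist S x y + K)%N /\
    (word_dist S x y <= K * word_dist T (q x) (q y) + K)%N.
Proof.
move=> [L [C [L1 C0 LC _]]].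
have L0 : 0 < L by exact: lt_le_trans L1.
have CLC : C <= L * C by rewrite ler_peMl.
(* The lower bound becomes [d <= L * d' + L * C], so one integer above both [L] and [L * C], hence
   above [C], serves for both inequalities. *)
pose K := (Num.truncn (L + L * C)).+1.
have LCK : L + L * C <= K%:R by rewrite ltW// truncnS_gt.
have LK : L <= K%:R by apply: le_trans LCK; rewrite lerDl mulr_ge0// ltW.
have LC'K : L * C <= K%:R by apply: le_trans LCK; rewrite lerDr ltW.
exists K; move: K LCK LK LC'K => K LCK LK LC'K x y; have /andP[lo hi] := LC x y.
rewrite -!(ler_nat R) !natrD !natrM; split.
  apply: (le_trans hi); rewrite lerD ?ler_wpM2r//.
  exact: le_trans LC'K.
move: lo; rewrite lerBlDr mulrC ler_pdivrMr// mulrC mulrDr => lo.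
by apply: (le_trans lo); rewrite lerD ?ler_wpM2r.
Qed.

Variables (G H : groupType) (S : seq G) (T : seq H) (q : G -> H) (K : nat).
Hypotheses (Sgen : generates S) (Tgen : generates T).
Hypothesis q_qi : forall x y,
    (word_dist T (q x) (q y) <= K * word_dist S x y + K)%N /\
    (word_dist S x y <= K * word_dist T (q x) (q y) + K)%N.

Lemma coarse_sub_qi (A B : set G) :
  coarse_sub T (q @` A) (q @` B) <-> coarse_sub S A B.
Proof.
split=> [[n AB]|[n AB]]; exists (K * n + K)%N.
  move=> a Aa; have [|_ [b Bb <-] ab] := AB (q a); first by exists a.
  exists b => //; have [_ le] := q_qi a b.
  by apply: leq_trans le _; rewrite leq_add2r leq_mul2l ab orbT.
move=> _ [a /AB[b Bb ab] <-]; exists (q b); first by exists b.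
have [le _] := q_qi a b.
by apply: leq_trans le _; rewrite leq_add2r leq_mul2l ab orbT.
Qed.

Lemma coarse_eq_qi (A B : set G) :
  coarse_eq T (q @` A) (q @` B) <-> coarse_eq S A B.
Proof. by rewrite /coarse_eq !coarse_sub_qi. Qed.

(** The map need not be injective, but points with images within [n] of [z] have images within
    [n + n] of each other, so they lie in one ball of [G]. *)
Lemma finite_qi_preimage_ball (z : H) n :
  finite_set [set x | (word_dist T (q x) z <= n)%N].
Proof.
have [[x0 x0z]|nox] := pselect (exists x, (word_dist T (q x) z <= n)%N); last first.
  by apply: sub_finite_set (finite_set0 _) => x xz; apply: nox; exists x.
apply: sub_finite_set (finite_dist_ball Sgen x0 (K * (n + n) + K)) => x xz /=.
have [_ le] := q_qi x0 x.
apply: leq_trans le _; rewrite leq_add2r leq_mul2l; apply/orP; right.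
apply: leq_trans (word_dist_leD Tgen z _ _) _.
by rewrite leq_add// word_dist_sym.
Qed.

End QuasiIsometries.

Theorem theorem3p9 (R : realType) (G H : groupType) (S : seq G) (T : seq H)
    (Ps : set (set G)) (Qs : set (set H))
    (hG : group_pair S Ps) (hH : group_pair T Qs)
    (hqi : quasi_isometric_pairs R S T Ps Qs) :
  reducible Ps <-> reducible Qs.
Proof.
have Sgen := group_pair_generates hG; have Tgen := group_pair_generates hH.
case: hqi => q [M [/quasi_isometry_nat[K qK] _ PQ QP]].
rewrite (reducible_coarsely_finite Sgen hG) (reducible_coarsely_finite Tgen hH).
pose r A B := (hdist T (image A q) B < M%:E)%E.
have rE A B : r A B -> coarse_eq T (image A q) B.
  move=> /(hdist_ltP Tgen)[AB BA]; split; exists (Num.truncn M) => // b /BA[a Aa ab].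
  by exists a => //; rewrite word_dist_sym.
have qE := coarse_eq_qi qK.
split.
- apply: (@finite_class_transfer _ _ _ _ _ _ r) => //.
  (* The chain is [q A], [B], [B'], [q A']. *)
  + move=> A A' B B' /rE AB /rE AB' BB'; apply/qE.
    apply: (coarse_eq_trans Tgen AB); apply: (coarse_eq_trans Tgen BB').
    exact: coarse_eq_sym.
  (* Every partner of [A] meets the finite ball around [q a]. *)
  + move=> A /(coset_nonempty hG)[a Aa].
    apply: sub_finite_set (finite_cosets_meeting hH
      (finite_dist_ball Tgen (q a) (Num.truncn M))) => B [QB /(hdist_ltP Tgen)[AB _]].
    split=> //; have [|b Bb ab] := AB (q a); first by exists a.
    by exists b.
- apply: (@finite_class_transfer _ _ _ _ _ _ (fun B A => r A B)) => //.
  + move=> B B' A A' /rE AB /rE AB' /qE AA'.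
    apply: (coarse_eq_trans Tgen (coarse_eq_sym AB)).
    exact: (coarse_eq_trans Tgen AA').
  (* Every partner of [B] meets the preimage under [q] of a ball around [b], which is finite. *)
  + move=> B /(coset_nonempty hH)[b Bb].
    apply: sub_finite_set (finite_cosets_meeting hG
      (finite_qi_preimage_ball Sgen Tgen qK b (Num.truncn M))) => A [PA /(hdist_ltP Tgen)[_ BA]].
    split=> //; have [_ [a Aa <-] ab] := BA b Bb.
    by exists a.
Qed.
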